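(* Let $P$ be a poset, let $\alpha$ be a non-zero countable ordinal, and let $\varepsilon\in[\omega,\omega_1)$. If $P^\alpha$ is $\varepsilon$-wqo, then $P^{<\alpha}$ is $\varepsilon$-wqo.
   Context: For a poset $P$ and ordinal $\alpha$, $P^\alpha$ is the poset obtained by factoring the quasi-order on the set of all $\alpha$-sequences from $P$ given by $s\le t$ iff there is a strictly increasing $\rho:\alpha\to\alpha$ with $s(\gamma)\le_P t(\rho(\gamma))$ for all $\gamma<\alpha$ (factoring by $s\sim t$ iff $s\le t$ and $t\le s$). $P^{<\alpha}$ is defined similarly on the set of all sequences of length $<\alpha$ from $P$, with $s\le t$ iff there is a strictly increasing $\rho:\mathrm{dom}(s)\to\mathrm{dom}(t)$ with $s(\gamma)\le_P t(\rho(\gamma))$ for all $\gamma\in\mathrm{dom}(s)$ (embeddability order). A barrier is an infinite set $B\subseteq[\omega]^{<\omega}$ which is an antichain under $\subseteq$ and such that every infinite subset of its base $\bigcup B$ has an initial segment (set of its $k$ smallest elements, some $k$) in $B$. Barriers are well-ordered by the lexicographic order (comparing increasing enumerations); the type of a barrier is this order type. For nonempty $r$ and $s$ in $[\omega]^{<\omega}$, $r\triangleleft s$ means $\min r<\min s$ and $r\setminus\{\min r\}$ is a proper initial segment of $s$. A map $f:B\to P$ from a barrier is good if there are $s\triangleleft t$ in $B$ with $f(s)\le_P f(t)$. For $\alpha<\omega_1$, $P$ is $\alpha$-wqo iff every map $f:B\to P$ from a barrier $B$ of type $\le\alpha$ is good. *)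

(* Defs.v *)
From HB Require Import structures.
From mathcomp Require Import all_boot all_order.
From mathcomp Require Import finmap.
From mathcomp Require Import boolp classical_sets functions cardinality wochoice.

Set Implicit Arguments.
Unset Strict Implicit.
Unset Printing Implicit Defensive.

Import Order.TTheory.

Local Open Scope classical_set_scope.
Local Open Scope quotient_scope.
Local Open Scope order_scope.

(* The poset obtained from a quasi-order by factoring by x <= y /\ y <= x. *)
Section Antisymmetrization.
Context {d : Order.disp_t} (T : preorderType d).

Definition order_equiv (x y : T) : bool := (x <= y) && (y <= x).

Lemma order_equiv_refl : reflexive order_equiv.
Proof. by move=> x; rewrite /order_equiv lexx. Qed.

Lemma order_equiv_sym : symmetric order_equiv.
Proof. by move=> x y; rewrite /order_equiv andbC. Qed.

Lemma order_equiv_trans : transitive order_equiv.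
Proof.
move=> y x z /andP[xy yx] /andP[yz zy].
by rewrite /order_equiv (le_trans xy yz) (le_trans zy yx).
Qed.

Canonical order_equiv_equiv :=
  EquivRel order_equiv order_equiv_refl order_equiv_sym order_equiv_trans.

Definition antisymmetrization := {eq_quot order_equiv}.
HB.instance Definition _ := Choice.on antisymmetrization.
HB.instance Definition _ := EqQuotient.on antisymmetrization.

(* Independent of the representatives: see le_pi. *)
Definition quot_le (x y : antisymmetrization) : bool := repr x <= repr y.

Lemma repr_pi (x : T) :
  (repr (\pi_antisymmetrization x) <= x) && (x <= repr (\pi_antisymmetrization x)).
Proof.
by have /eqmodP := reprK (\pi_antisymmetrization x).
Qed.

Lemma quot_le_refl : reflexive quot_le.
Proof. by move=> x; apply: lexx. Qed.

Lemma quot_le_anti : antisymmetric quot_le.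
Proof. by move=> x y xy; rewrite -[x]reprK -[y]reprK; apply/eqmodP. Qed.

Lemma quot_le_trans : transitive quot_le.
Proof. by move=> y x z; apply: le_trans. Qed.

HB.instance Definition _ := Order.Le_isPOrder.Build d antisymmetrization
  quot_le_refl quot_le_anti quot_le_trans.

Lemma le_pi (x y : T) :
  (\pi_antisymmetrization x <= \pi_antisymmetrization y) = (x <= y).
Proof.
rewrite [LHS]/(quot_le _ _) /quot_le.
have /andP[x1 x2] := repr_pi x; have /andP[y1 y2] := repr_pi y.
apply/idP/idP => [xy|xy]; first exact: le_trans x2 (le_trans xy y1).
exact: le_trans x1 (le_trans xy y2).
Qed.

End Antisymmetrization.

Definition embeddable {dI dJ d : Order.disp_t} (I : porderType dI)
    (J : porderType dJ) (P : porderType d) (s : I -> P) (t : J -> P) : Prop :=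
  exists rho : I -> J,
    {homo rho : x y / x < y} /\ forall x, s x <= t (rho x).

Section EmbeddableTheory.
Context {d : Order.disp_t} (P : porderType d).

Lemma embeddable_refl dI (I : porderType dI) (s : I -> P) : embeddable s s.
Proof. by exists id; split=> // x; apply: lexx. Qed.

Lemma embeddable_trans dI dJ dK (I : porderType dI) (J : porderType dJ)
    (K : porderType dK) (s : I -> P) (t : J -> P) (u : K -> P) :
  embeddable s t -> embeddable t u -> embeddable s u.
Proof.
move=> [f [f_incr sf]] [g [g_incr tg]]; exists (g \o f); split.
  by move=> x y /f_incr/g_incr.
by move=> x; apply: le_trans (sf x) (tg _).
Qed.

End EmbeddableTheory.

(* An ordinal is represented by a well-ordered type A; the ordinals below it *)
(* are then the proper initial segments [seg a], for a : A.                  *)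
Section Segment.
Context {d : Order.disp_t} (A : orderType d) (a : A).

Definition seg := {x : A | x < a}.
HB.instance Definition _ := SubChoice.on seg.
HB.instance Definition _ := [SubChoice_isSubOrder of seg by <: with d].

End Segment.

Section Sequences.
Context {dA d : Order.disp_t} (A : orderType dA) (P : porderType d).

(* All A-sequences from P. *)
Definition pow_seq := A -> P.
HB.instance Definition _ := gen_eqMixin pow_seq.
HB.instance Definition _ := gen_choiceMixin pow_seq.

Definition pow_seq_le (s t : pow_seq) : bool := `[< embeddable s t >].

Lemma pow_seq_le_refl : reflexive pow_seq_le.
Proof. by move=> s; apply/asboolP/embeddable_refl. Qed.

Lemma pow_seq_le_trans : transitive pow_seq_le.
Proof.
move=> t s u /asboolP st /asboolP tu; apply/asboolP.
exact: embeddable_trans st tu.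
Qed.

HB.instance Definition _ :=
  Order.Le_isPreorder.Build d pow_seq pow_seq_le_refl pow_seq_le_trans.

Definition pow := antisymmetrization pow_seq.
HB.instance Definition _ := Order.POrder.on pow.

(* All sequences from P of length < A. *)
Definition lpow_seq := {a : A & seg a -> P}.
HB.instance Definition _ := gen_eqMixin lpow_seq.
HB.instance Definition _ := gen_choiceMixin lpow_seq.

Definition lpow_seq_le (s t : lpow_seq) : bool :=
  `[< embeddable (tagged s) (tagged t) >].

Lemma lpow_seq_le_refl : reflexive lpow_seq_le.
Proof. by move=> s; apply/asboolP/embeddable_refl. Qed.

Lemma lpow_seq_le_trans : transitive lpow_seq_le.
Proof.
move=> t s u /asboolP st /asboolP tu; apply/asboolP.
exact: embeddable_trans st tu.
Qed.

HB.instance Definition _ :=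
  Order.Le_isPreorder.Build d lpow_seq lpow_seq_le_refl lpow_seq_le_trans.

Definition lpow := antisymmetrization lpow_seq.
HB.instance Definition _ := Order.POrder.on lpow.

End Sequences.

(* s consists of the k smallest elements of X, where k = #|` s|. *)
Definition initial_segment (s : {fset nat}) (X : set nat) : Prop :=
  [set` s] `<=` X /\
  (forall x y, x \in s -> X y -> y \notin s -> (x < y)%N).

Definition base (B : set {fset nat}) : set nat := \bigcup_(s in B) [set` s].

Definition barrier (B : set {fset nat}) : Prop :=
  [/\ infinite_set B,
      (forall s t, B s -> B t -> (s `<=` t)%fset -> s = t) &
      forall X : set nat, infinite_set X -> X `<=` base B ->
        exists2 s, B s & initial_segment s X].

Definition increasing_enum (s : {fset nat}) : seq nat := sort leq s.

(* [seqlexi nat] is [seq nat] with the lexicographic order. *)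
Definition lex_lt (s t : {fset nat}) : bool :=
  (increasing_enum s : seqlexi nat) < (increasing_enum t : seqlexi nat).

(* The value 0 for s = fset0 is junk. *)
Definition fset_min (s : {fset nat}) : nat := head 0%N (increasing_enum s).

Definition triangle (r s : {fset nat}) : Prop :=
  [/\ r != fset0, s != fset0, (fset_min r < fset_min s)%N,
      initial_segment (r `\ fset_min r)%fset [set` s] &
      (r `\ fset_min r)%fset != s].

Definition good {d : Order.disp_t} (P : porderType d) (B : set {fset nat})
    (f : B -> P) : Prop :=
  exists s t : B, triangle (val s) (val t) /\ f s <= f t.

(* (T, R) is isomorphic to an initial segment of (U, S); for well-orders, the *)
(* order type of (T, R) is at most that of (U, S).                            *)
Definition otype_le (T U : Type) (R : rel T) (S : rel U) : Prop :=
  exists h : T -> U,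
    {homo h : x y / R x y >-> S x y} /\
    (forall x u, S u (h x) -> exists y, h y = u).

Definition barrier_type_le (B : set {fset nat}) {d : Order.disp_t}
    (E : orderType d) : Prop :=
  otype_le (fun s t : B => lex_lt (val s) (val t)) (<%O : rel E).

(* P is E-wqo, for E a well-ordered type standing for its order type. *)
Definition wqo {dE d : Order.disp_t} (E : orderType dE) (P : porderType d) :
    Prop :=
  forall B : set {fset nat}, barrier B -> barrier_type_le B E ->
  forall f : B -> P, good f.

Definition countable_ordinal {d : Order.disp_t} (A : orderType d) : Prop :=
  well_order (<=%O : rel A) /\ countable [set: A].

(* Main.v *)
Require Import Defs.
From mathcomp Require Import all_boot all_order finmap.
From mathcomp Require Import boolp classical_sets cardinality wochoice.

(* Since P^A is wqo along the singletons, P is empty or has a minimal element *)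
(* p. Pad a sequence l of length < A with p to an A-sequence. An embedding    *)
(* between padded sequences cannot send a term lying before the final block   *)
(* of p's of l into the final block of the target, because p is minimal; so   *)
(* it yields an embedding of the original sequences as soon as the length w l *)
(* of the final block does not decrease. Since w takes values in a            *)
(* well-order, Ramsey's theorem for open sets of infinite subsets of nat      *)
(* shrinks any barrier to one on which w s <= w t whenever s <| t, and        *)
(* shrinking does not increase the type of the barrier.                       *)

Set Implicit Arguments.
Unset Strict Implicit.
Unset Printing Implicit Defensive.

Import Order.TTheory.

Local Open Scope classical_set_scope.

(** * Ramsey's theorem for open sets *)

(** Padding alone does not reflect the order: a final block of [p]'s in [l] may be absorbed by the
    padding of the target. What is lost is a single element of the well-order [A], the length [w l]
    of that block, and [exists_padding] shows that [pad l <= pad m] together with [w l <= w m] gives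
    [l <= m].

    It therefore suffices to make two maps good at the same pair [s], [t], one into P^A and one into
    a well-order; this is [wqo_pair]. By [barrier_monotone], every barrier contains a sub-barrier on
    which [w s <= w t] for all [triangle s t]: the other side of the Ramsey dichotomy would make [w]
    strictly decrease forever along a chain of triangles. The sub-barrier is still of type at most E
    by [mostowski_collapse], so the wqo hypothesis on P^A applies to it.

    The minimal [p] comes from [wqo_pow_minimal], where A is nonempty and E is at least omega:
    constant sequences along an infinite descent in P would be bad on the barrier of singletons. *)

Lemma infinite_natP (X : set nat) :
  infinite_set X <-> forall n, exists2 x, X x & (n <= x)%N.
Proof.
split=> [Xinf n|Xunb Xfin].
  apply: contrapT => nX; apply: Xinf; apply: (sub_finite_set _ (finite_II n)).
  move=> x Xx /=; rewrite ltnNge; apply/negP => nx; apply: nX.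
  by exists x.
have /finite_fsetP[s Xs] := Xfin.
have [x] := Xunb (\max_(i <- enum_fset s) i).+1.
rewrite Xs /= => sx; rewrite ltnNge => /negP; apply.
exact: (@leq_bigmax_seq _ _ xpredT id).
Qed.

Lemma infinite_above (X : set nat) n :
  infinite_set X -> infinite_set (X `&` [set k | (n <= k)%N]).
Proof.
move=> /infinite_natP Xinf; apply/infinite_natP => m.
have [x Xx] := Xinf (maxn m n); rewrite geq_max => /andP[mx nx].
by exists x.
Qed.

Lemma set_nat_min (X : set nat) :
  X !=set0 -> exists2 m, X m & forall x, X x -> (m <= x)%N.
Proof.
move=> [x Xx]; have X_ex : exists n, `[< X n >] by exists x; apply/asboolP.
exists (ex_minn X_ex); first by case: ex_minnP => m /asboolP.
by move=> y /asboolP Xy; case: ex_minnP => m _; apply.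
Qed.

Section Fusion.
Variable Q : set nat -> set nat -> Prop.
Hypothesis Q_sub : forall a X Y, Y `<=` X -> Q a X -> Q a Y.
Hypothesis Q_dense : forall a X, infinite_set X ->
  exists Y, [/\ infinite_set Y, Y `<=` X & Q a Y].

(** Only finitely many [a] lie in [I_n], so density is applied once for each. The induction varies
    [Q]: sets containing [n] are handled by the shifted property [Q (a U {n})]. *)
Lemma dense_bounded n X : infinite_set X -> exists Y,
  [/\ infinite_set Y, Y `<=` X & forall a, a `<=` `I_n -> Q a Y].
Proof.
elim: n Q Q_sub Q_dense X => [|n IH] R R_sub R_dense X Xinf.
  have [Y [Yinf YX RY]] := R_dense set0 X Xinf; exists Y; split=> // a.
  by rewrite II0 subset0 => ->.
have [Y [Yinf YX RY]] := IH R R_sub R_dense X Xinf.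
have [|a|Z [Zinf ZY RZ]] := IH (fun a => R (a `|` [set n])) _ _ Y Yinf.
- by move=> a U V; apply: R_sub.
- exact: R_dense.
exists Z; split=> // [x /ZY/YX//|a aS].
have [an|an] := pselect (a n).
  have -> : a = (a `\ n) `|` [set n].
    rewrite eqEsubset; split=> x; last by case=> [[]|->].
    by move=> ax; have [->|/eqP xn] := eqVneq x n; [right|left].
  apply: RZ => x [/aS /=]; rewrite ltnS leq_eqVlt => /orP[/eqP //|//].
apply: R_sub ZY _; apply: RY => x ax.
have := aS x ax; rewrite /= ltnS leq_eqVlt => /orP[/eqP xn|//].
by rewrite xn in ax.
Qed.

(** Diagonalization: pick [k i] in [Z i], then shrink to [Z i.+1], above [k i] and good for all [a]
    bounded by [k i]. The set of all [k i] works. *)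
Lemma fusion X : infinite_set X -> exists Y, [/\ infinite_set Y, Y `<=` X &
  forall n a, a `<=` Y `&` `I_n -> Q a (Y `&` [set k | (n <= k)%N])].
Proof.
move=> Xinf; have [X0 [X0inf X0X QX0]] := Q_dense set0 Xinf.
pose T := {Z : set nat | infinite_set Z}.
have next (Z : T) : exists kZ' : nat * T, [/\ sval Z kZ'.1,
    sval kZ'.2 `<=` sval Z `&` [set k | (kZ'.1 < k)%N] &
    forall a, a `<=` `I_(kZ'.1.+1) -> Q a (sval kZ'.2)].
  case: Z => Z /= Zinf; have [k Zk] := infinite_setN0 Zinf.
  have [U [Uinf UZ QU]] := dense_bounded k.+1 (infinite_above (n := k.+1) Zinf).
  by exists (k, exist _ U Uinf).
have [F FP] := choice next.
pose Z i : T := iter i (fun Z => (F Z).2) (exist _ X0 X0inf).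
pose k i := (F (Z i)).1.
have ZS i : Z i.+1 = (F (Z i)).2 by [].
have Zk i : sval (Z i) (k i) by have [] := FP (Z i).
have ZZ i : sval (Z i.+1) `<=` sval (Z i) `&` [set m | (k i < m)%N].
  by rewrite ZS; have [] := FP (Z i).
have QZ i a : a `<=` `I_(k i).+1 -> Q a (sval (Z i.+1)).
  by rewrite ZS; have [_ _] := FP (Z i); apply.
have Zle i j : (i <= j)%N -> sval (Z j) `<=` sval (Z i).
  move=> /subnK <-; elim: (j - i)%N => // n IH x.
  by rewrite addSn => /ZZ[/IH].
have k_incr i j : (i < j)%N -> (k i < k j)%N.
  by move=> ij; have [] := ZZ i _ (Zle _ _ ij _ (Zk j)).
have k_le i j : (i <= j)%N -> (k i <= k j)%N.
  by rewrite leq_eqVlt => /predU1P[->//|/k_incr/ltnW].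
have k_ge i : (i <= k i)%N.
  by elim: i => // i IH; apply: leq_ltn_trans IH (k_incr _ _ _).
exists (range k); split.
- apply/infinite_natP => n; exists (k n) => //; by exists n.
- by move=> _ [i _ <-]; apply: X0X; apply: (Zle 0%N i).
move=> n a aY.
have ex_i : exists i, (n <= k i)%N by exists n.
(* With [i] least such that [n <= k i], the set [a] consists of some [k j] with [j < i], while the
   part of the range from [n] on lies in [Z i]. *)
have [i nki i_min] := ex_minnP ex_i.
have YZ : range k `&` [set m | (n <= m)%N] `<=` sval (Z i).
  by move=> _ [[j _ <-] /= /i_min ij]; apply: Zle (Zk j).
have aP x : a x -> exists2 j, (j < i)%N & x = k j.
  move=> /aY[[j _ <-] /= kjn]; exists j => //.
  rewrite ltnNge; apply/negP => /k_le; apply/negP; rewrite -ltnNge.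
  exact: leq_trans kjn nki.
apply: Q_sub YZ _; case: i aP {nki i_min} => [|i] aP.
  by suff -> : a = set0 by []; rewrite -subset0 => x /aP[].
by apply: QZ => x /aP[j ji ->]; rewrite /= ltnS k_le.
Qed.
End Fusion.

(* Combinatorial forcing, as in the Galvin-Prikry theorem. *)
Section OpenRamsey.
Variable O : set nat -> Prop.
Hypothesis O_open : forall Y, infinite_set Y -> O Y ->
  exists n, forall Z, infinite_set Z -> Z `&` `I_n = Y `&` `I_n -> O Z.

Definition above (a Y : set nat) := forall x y, a x -> Y y -> (x < y)%N.

Definition accepts a X := forall Y, infinite_set Y -> Y `<=` X -> above a Y ->
  O (a `|` Y).

Definition rejects a X := forall Y, infinite_set Y -> Y `<=` X ->
  ~ accepts a Y.

Let accepts_sub a X Y : Y `<=` X -> accepts a X -> accepts a Y.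
Proof. by move=> YX aX Z Zinf ZY; apply: aX => //; apply: subset_trans YX. Qed.

Let rejects_sub a X Y : Y `<=` X -> rejects a X -> rejects a Y.
Proof. by move=> YX aX Z Zinf ZY; apply: aX => //; apply: subset_trans YX. Qed.

Let rejects_above n a X : rejects a (X `&` [set k | (n <= k)%N]) -> rejects a X.
Proof.
move=> rX Y Yinf YX aY; apply: (rX (Y `&` [set k | (n <= k)%N])).
- exact: infinite_above.
- by move=> x [/YX].
- by apply: accepts_sub aY => x [].
Qed.

(** If no infinite subset of [X] accepts [a], then [X] rejects [a] by definition; so being decided
    is dense and [fusion] applies. *)
Let decided X : infinite_set X -> exists Y, [/\ infinite_set Y, Y `<=` X,
  accepts set0 Y \/ rejects set0 Y & forall a m, Y m -> a `<=` Y `&` `I_m ->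
    accepts (a `|` [set m]) Y \/ rejects (a `|` [set m]) Y].
Proof.
move=> Xinf.
have [|a Z Zinf|Y [Yinf YX Ydec]] :=
    @fusion (fun a X => accepts a X \/ rejects a X) _ _ X Xinf.
- move=> a U V VU [aU|rU]; [left|right].
    exact: accepts_sub VU aU.
  exact: rejects_sub VU rU.
- have [[U [Uinf UZ aU]]|nU] := pselect (exists U,
      [/\ infinite_set U, U `<=` Z & accepts a U]).
    by exists U; split=> //; left.
  exists Z; split=> //; right=> U Uinf UZ aU; apply: nU; by exists U.
exists Y; split=> //.
  have [] // := Ydec 0%N set0.
  - by move=> aY; left; apply: accepts_sub aY => x Yx.
  - by move/rejects_above; right.
move=> a m Ym aYm; have [x []|aY|/rejects_above] := Ydec m.+1 (a `|` [set m]).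
- by move=> /aYm[Yx /= /ltnW xm]; split.
- by move=> ->; split=> /=.
- left=> Z Zinf ZY amZ; apply: aY => // x Zx; split; first exact: ZY.
  by apply: amZ => //; right.
- by right.
Qed.

(** Were [a U {m}] accepted for infinitely many [m] in [Y], the set [U] of these [m] would accept
    [a]: split any infinite subset of [U] at its minimum. So discarding finitely many points is
    enough. *)
Let reject_extensions X a Y : infinite_set Y -> Y `<=` X -> rejects a X ->
  exists Z, [/\ infinite_set Z, Z `<=` Y & forall m, Z m -> above a [set m] ->
    ~ accepts (a `|` [set m]) X].
Proof.
move=> Yinf YX rX.
pose U := Y `&` [set m | above a [set m] /\ accepts (a `|` [set m]) X].
have [Ufin|Uinf] := pselect (finite_set U).
  exists (Y `\` U); split; first exact: infinite_setD.
    by move=> x [].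
  by move=> m [Ym nU] am aX; apply: nU.
case: (rX U Uinf) => [x [/YX]//|Z Zinf ZU aZ].
have [m Zm m_min] := set_nat_min (infinite_setN0 Zinf).
have [_ /= [am aX]] := ZU m Zm.
have -> : a `|` Z = (a `|` [set m]) `|` (Z `&` [set k | (m < k)%N]).
  rewrite eqEsubset; split=> x.
    move=> [ax|Zx]; [by left; left|].
    have := m_min x Zx; rewrite leq_eqVlt => /predU1P[<-|mx].
      by left; right.
    by right.
  move=> [[ax|->]|[Zx _]]; [by left| by right| by right].
apply: aX; first exact: infinite_above.
  by move=> x [/ZU[/YX]].
move=> x y [ax|->] [Zy] //= my; exact: aZ.
Qed.

(** If the empty set is accepted, the first alternative holds. Otherwise fusion makes rejection pass
    from [a] to [a U {m}], so every finite initial part of a [Z] inside [Y] is rejected; but if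
    [O Z] held, openness would make one of them accepted. *)
Lemma open_ramsey X : infinite_set X -> exists Y, [/\ infinite_set Y, Y `<=` X &
  (forall Z, infinite_set Z -> Z `<=` Y -> O Z) \/
  (forall Z, infinite_set Z -> Z `<=` Y -> ~ O Z)].
Proof.
move=> /decided[X1 [X1inf X1X dec0 dec]].
have [acc0|rej0] := dec0.
  exists X1; split=> //; left=> Z Zinf ZX1; rewrite -(set0U Z).
  by apply: acc0 => // x y.
have [|a Y Yinf|Y [Yinf YX1 YP]] := @fusion (fun a Y => a `<=` X1 ->
    rejects a X1 -> forall m, X1 m -> Y m -> above a [set m] ->
    rejects (a `|` [set m]) X1) _ _ X1 X1inf.
- by move=> a U V VU QU aX1 rX1 m X1m Vm; apply: QU => //; apply: VU.
- have [ra|nra] := pselect (rejects a X1); last by exists Y; split.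
  have [YX1fin|YX1inf] := pselect (finite_set (Y `&` X1)).
    exists (Y `\` (Y `&` X1)); split; first exact: infinite_setD.
      by move=> x [].
    by move=> _ _ m X1m [Ym []].
  have [|Z [Zinf ZY Zna]] := reject_extensions YX1inf _ ra; first by move=> x [].
  exists Z; split=> // [x /ZY[]//|aX1 _ m X1m Zm am].
  have [x ax|aX1m|//] := dec a m X1m _.
  - by split; [apply: aX1|apply: am].
  - by have := Zna m Zm am.
exists Y; split=> //; first exact: subset_trans X1X.
right=> Z Zinf ZY OZ; have [n Zn] := O_open Zinf OZ.
have rejZ k : rejects (Z `&` `I_k) X1.
  elim: k => [|k IH]; first by rewrite II0 setI0.
  have [Zk|nZk] := pselect (Z k); last first.
    suff -> : Z `&` `I_k.+1 = Z `&` `I_k by [].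
    rewrite eqEsubset; split=> x [Zx /= xk]; split=> //=; last exact: ltnW.
    by move: xk; rewrite ltnS leq_eqVlt => /predU1P[xk|//]; rewrite xk in Zx.
  have -> : Z `&` `I_k.+1 = (Z `&` `I_k) `|` [set k].
    rewrite eqEsubset; split=> x.
      move=> [Zx /=]; rewrite ltnS leq_eqVlt => /predU1P[->|xk].
        by right.
      by left.
    by move=> [[Zx /= /ltnW xk]|->]; split=> //=.
  apply: (YP k (Z `&` `I_k)) => //.
  - by move=> x [/ZY Yx xk].
  - by move=> x [/ZY/YX1].
  - exact/YX1/ZY.
  - by split; [apply: ZY|rewrite /=].
  - by move=> x y [_ /= xk] ->.
apply: (rejZ n _ (infinite_above (n := n) X1inf)) => [x []//|V Vinf VX1 aV].
apply: Zn.
  by apply: sub_infinite_set Vinf => x; right.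
rewrite setIUl -setIA setIid setUidl // => x [/VX1[_ /= nx]].
by rewrite /= ltnNge nx.
Qed.
End OpenRamsey.

(** * Barriers *)

Lemma well_order_min d (A : orderType d) (Q : A -> Prop) :
  well_order (<=%O : rel A) -> (exists x, Q x) ->
  exists2 x, Q x & forall y, Q y -> (x <= y)%O.
Proof.
move=> Awo [x Qx]; have [|z [[Qz z_min] _]] := Awo (fun y => `[< Q y >]).
  by exists x; apply/asboolP.
by exists z; [apply/asboolP|move=> y Qy; apply: z_min; apply/asboolP].
Qed.

Lemma fset_minP (s : {fset nat}) : s != fset0 ->
  fset_min s \in s /\ forall x, x \in s -> (fset_min s <= x)%N.
Proof.
rewrite /fset_min /increasing_enum => s0.
have : sorted leq (sort leq s) by apply/sort_sorted/leq_total.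
have mem_s x : (x \in sort leq s) = (x \in s) by rewrite mem_sort.
case: (sort leq s) mem_s => [|m r] mem_s /=.
  by case/fset0Pn: s0 => x; rewrite -mem_s.
move=> /(order_path_min leq_trans)/allP m_min.
rewrite -mem_s mem_head; split=> // x; rewrite -mem_s inE.
by case/predU1P => [->|/m_min].
Qed.

Lemma initial_segment_comparable s t Y : initial_segment s Y ->
  initial_segment t Y -> (s `<=` t)%fset \/ (t `<=` s)%fset.
Proof.
move=> [sY s_init] [tY t_init].
have [|/fsubsetPn[x xs xt]] := boolP (s `<=` t)%fset; first by left.
right; apply/fsubsetP => y yt; apply: contraT => ys.
have xy := s_init x y xs (tY y yt) ys.
by have := t_init y x yt (sY x xs) xt; rewrite ltnNge (ltnW xy).
Qed.

(* [Y] without its minimum. *)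
Definition set_behead (Y : set nat) : set nat :=
  Y `&` [set k | exists2 m, Y m & (m < k)%N].

Lemma set_behead_infinite Y : infinite_set Y -> infinite_set (set_behead Y).
Proof.
move=> Yinf; have [m Ym] := infinite_setN0 Yinf.
apply: sub_infinite_set (infinite_above (n := m.+1) Yinf) => k [Yk mk].
by split=> //; exists m.
Qed.

(** With the converse [initial_segments_triangle], this turns triangles in a barrier into a property
    of infinite sets [Y]: [s] starts [Y], and [t] starts [Y] without its minimum. Ramsey's theorem
    can then be applied. *)
Lemma triangle_initial_segments s t Y : triangle s t ->
    initial_segment (s `|` t)%fset Y ->
  initial_segment s Y /\ initial_segment t (set_behead Y).
Proof.
move=> [s0 t0 mst [st st_init] _] [stY Y_init].
have [ms s_min] := fset_minP s0; have [mt t_min] := fset_minP t0.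
set m := fset_min s in mst st st_init ms s_min.
have sY x : x \in s -> Y x by move=> xs; apply: stY; rewrite /= inE xs.
have tY x : x \in t -> Y x by move=> xt; apply: stY; rewrite /= inE xt orbT.
have m_lt x : x \in t -> (m < x)%N by move=> /t_min; apply: leq_trans.
have m_min x : Y x -> (m <= x)%N.
  move=> Yx; have [|xst] := boolP (x \in (s `|` t)%fset).
    by rewrite inE => /orP[/s_min//|/m_lt/ltnW].
  by apply/ltnW/Y_init; rewrite // inE ms.
split; split=> //.
- move=> x y xs Yy ys; have [yt|yt] := boolP (y \in t); last first.
    by apply: Y_init; rewrite ?inE ?xs // negb_or ys.
  have [->|xm] := eqVneq x m; first exact: m_lt.
  by apply: st_init; rewrite // !inE ?xm ?xs // negb_and ys orbT.
- by move=> x xt; split; [apply: tY|exists m; [apply: sY|apply: m_lt]].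
- move=> x y xt [Yy [z Yz zy]] yt.
  have [ys|ys] := boolP (y \in s); last first.
    by apply: Y_init; rewrite ?inE ?xt ?orbT // negb_or ys.
  have [ym|ym] := eqVneq y m.
    by have := m_min z Yz; rewrite leqNgt -ym zy.
  by have /negP[] := yt; apply: st; rewrite /= !inE ym.
Qed.

Section Barrier.
Variable B : set {fset nat}.
Hypothesis B_barrier : barrier B.

Lemma barrier_neq0 s : B s -> s != fset0.
Proof.
case: B_barrier => Binf Banti _ Bs; apply/eqP => s0; apply: Binf.
apply: sub_finite_set (finite_set1 s) => t Bt /=.
by apply/esym/Banti; rewrite // s0 fsub0set.
Qed.

Lemma barrier_initial_segment_inj s t Y : B s -> B t ->
  initial_segment s Y -> initial_segment t Y -> s = t.
Proof.
case: B_barrier => _ Banti _ Bs Bt sY tY.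
have [st|ts] := initial_segment_comparable sY tY; first exact: Banti.
by apply/esym/Banti.
Qed.

(** The antichain condition does the work: [t] inside [s] minus its minimum would force [t = s],
    although [t] would miss [fset_min s]. *)
Lemma initial_segments_triangle s t Y : B s -> B t ->
    initial_segment s Y -> initial_segment t (set_behead Y) ->
  triangle s t /\ initial_segment (s `|` t)%fset Y.
Proof.
move=> Bs Bt sY tY.
have s0 := barrier_neq0 Bs; have t0 := barrier_neq0 Bt.
have [ms s_min] := fset_minP s0; have [mt t_min] := fset_minP t0.
have [sYs s_init] := sY; have [tYs t_init] := tY.
have Ym : Y (fset_min s) by apply: sYs.
have m_min x : Y x -> (fset_min s <= x)%N.
  move=> Yx; have [/s_min//|xs] := boolP (x \in s).
  by apply/ltnW/s_init.
have sYb : initial_segment (s `\ fset_min s)%fset (set_behead Y).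
  split=> [x /=|x y].
    rewrite !inE => /andP[xm xs]; split; first exact: sYs.
    by exists (fset_min s); rewrite // ltn_neqAle eq_sym xm s_min.
  rewrite !inE => /andP[xm xs] [Yy [z Yz zy]]; rewrite negb_and negbK.
  case/orP => [/eqP ym|ys]; last exact: s_init.
  by have := m_min z Yz; rewrite leqNgt -ym zy.
have s_sub : (s `\ fset_min s `<=` t)%fset.
  have [//|ts] := initial_segment_comparable sYb tY.
  have [_ Banti _] := B_barrier.
  have ets : t = s by apply: Banti => //; apply: fsubset_trans ts (fsubD1set _ _).
  by have := fsubsetP ts (fset_min s); rewrite {1}ets => /(_ ms); rewrite !inE eqxx.
have [_ [z Yz zt]] := tYs _ mt.
split; split=> //.
- exact: leq_ltn_trans (m_min z Yz) zt.
- split=> [x /(fsubsetP s_sub)//|x y xs yt]; case: sYb => _; apply=> //.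
  exact: tYs.
- apply/eqP => e; have [_ Banti _] := B_barrier.
  have ets : t = s by apply: Banti => //; rewrite -e fsubD1set.
  by have := ms; rewrite -[X in _ \in X]ets -e !inE eqxx.
- by move=> x /=; rewrite inE => /orP[/sYs//|/tYs[]].
- move=> x y; rewrite !inE => xst Yy /norP[ys yt].
  case/orP: xst => [xs|xt]; first exact: s_init.
  apply: t_init => //; split=> //; exists (fset_min s) => //.
  by rewrite ltn_neqAle m_min // andbT; apply: contraNneq ys => <-.
Qed.

Lemma barrier_base_infinite : infinite_set (base B).
Proof.
have [Binf _ _] := B_barrier => bfin; apply: Binf.
have /finite_fsetP[b be] := bfin.
apply: sub_finite_set (finite_fset (fpowerset b)) => s Bs /=.
rewrite fpowersetE; apply/fsubsetP => x xs.
by have : base B x; [exists s|rewrite be].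
Qed.

Definition sub_barrier (X : set nat) : set {fset nat} :=
  [set s | B s /\ [set` s] `<=` X].

Lemma sub_barrierP X : infinite_set X -> X `<=` base B -> barrier (sub_barrier X).
Proof.
move=> Xinf XB; have [Binf Banti Binit] := B_barrier; split.
- move=> subfin; have /finite_fsetP[S Se] := subfin.
  (* [n] exceeds every element of every member of [S], yet [X] above [n] still starts with a member
     of the barrier. *)
  pose n := (\max_(s <- S) \max_(x <- s) x).+1.
  have [|s Bs [sX _]] := Binit _ (infinite_above (n := n) Xinf).
    by move=> x [/XB].
  have [ms _] := fset_minP (barrier_neq0 Bs).
  have [_ /=] := sX _ ms; apply/negP; rewrite -ltnNge ltnS.
  have sS : s \in S.
    suff : sub_barrier X s by rewrite Se.
    by split=> // x /sX[].
  apply: (@leq_trans (\max_(x <- s) x)); first exact: (@leq_bigmax_seq _ _ xpredT id).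
  exact: (@leq_bigmax_seq _ _ xpredT (fun s : {fset nat} => \max_(x <- s) x)).
- by move=> s t [Bs _] [Bt _]; apply: Banti.
- move=> Y Yinf YX.
  have YX' : Y `<=` X by move=> y /YX[s [_ sX] /sX].
  have [|s Bs sY] := Binit Y Yinf; first by move=> y /YX'/XB.
  by exists s => //; split=> // x /(proj1 sY)/YX'.
Qed.

(** [s i] is the member of the barrier that starts [X] with its [i] smallest elements removed. *)
Lemma barrier_chain X : infinite_set X -> X `<=` base B ->
  exists s : nat -> {fset nat}, forall i, [/\ B (s i), triangle (s i) (s i.+1) &
    exists Y, [/\ infinite_set Y, Y `<=` X &
               initial_segment (s i `|` s i.+1)%fset Y]].
Proof.
move=> Xinf XB; have [_ _ Binit] := B_barrier.
pose Y i := iter i set_behead X.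
have Yinf i : infinite_set (Y i) by elim: i => // i; apply: set_behead_infinite.
have YX i : Y i `<=` X by elim: i => // i IH x [/IH].
have /choice[s sP] i : exists s, B s /\ initial_segment s (Y i).
  have [|s Bs sY] := Binit _ (Yinf i); first by apply: subset_trans XB.
  by exists s.
exists s => i; have [Bs sY] := sP i; have [Bt tY] := sP i.+1.
have [st stY] := initial_segments_triangle Bs Bt sY tY.
by split=> //; exists (Y i).
Qed.

Lemma exists_triangle : exists s t, [/\ B s, B t & triangle s t].
Proof.
have [s sP] := barrier_chain barrier_base_infinite (fun x => id).
have [Bs st _] := sP 0%N; have [Bt _ _] := sP 1%N.
by exists (s 0%N), (s 1%N).
Qed.

Lemma barrier_monotone d (A : orderType d) (w : {fset nat} -> A) :
  well_order (<=%O : rel A) -> exists X, [/\ infinite_set X, X `<=` base B &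
    forall s t, sub_barrier X s -> sub_barrier X t -> triangle s t ->
      (w s <= w t)%O].
Proof.
move=> Awo.
(* [O] depends only on the finite initial segment [s U t] of [Y], hence is open. *)
pose O (Y : set nat) := exists s t, [/\ B s, B t, triangle s t,
  initial_segment (s `|` t)%fset Y & (w s <= w t)%O].
have O_open Y : infinite_set Y -> O Y ->
    exists n, forall Z, infinite_set Z -> Z `&` `I_n = Y `&` `I_n -> O Z.
  move=> _ [s [t [Bs Bt st [rY r_init] wst]]].
  pose n := (\max_(x <- (s `|` t)%fset) x).+1.
  have r_lt x : x \in (s `|` t)%fset -> (x < n)%N.
    by move=> xr; rewrite ltnS; apply: (@leq_bigmax_seq _ _ xpredT id).
  exists n => Z _ ZY; exists s, t; split=> //; split=> [x xr|x y xr Zy yr].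
    have : (Z `&` `I_n) x by rewrite ZY; split; [apply: rY|apply: r_lt].
    by case.
  have [yn|ny] := ltnP y n; last exact: leq_trans (r_lt x xr) ny.
  by apply: r_init => //; have : (Y `&` `I_n) y; [rewrite -ZY|case].
have [X [Xinf XB XO]] := open_ramsey O_open barrier_base_infinite.
exists X; split=> //; case: XO => XO s t; last first.
  (* This alternative is impossible: where [w] is least along the chain, it does not decrease at the
     next triangle. *)
  have [c cP] := barrier_chain Xinf XB.
  have [|_ [i _ <-] c_min] := @well_order_min _ A (range (w \o c)) Awo.
    by exists (w (c 0%N)), 0%N.
  have [Bs st [Y [Yinf YX stY]]] := cP i; have [Bt _ _] := cP i.+1.
  case: (XO Y) => //; exists (c i), (c i.+1); split=> //.
  by apply: c_min; exists i.+1.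
move=> [Bs sX] [Bt tX] st.
pose n := (\max_(x <- (s `|` t)%fset) x).+1.
have r_lt x : x \in (s `|` t)%fset -> (x < n)%N.
  by move=> xr; rewrite ltnS; apply: (@leq_bigmax_seq _ _ xpredT id).
(* The tail of [X] extends [s U t] to an infinite set. The pair that [O] provides for it must be
   [s], [t], since only one member of a barrier starts a given set. *)
pose Y := [set` (s `|` t)%fset] `|` (X `&` [set k | (n <= k)%N]).
have stY : initial_segment (s `|` t)%fset Y.
  split=> [x xr|x y xr [/= -> //|[_ ny] _]]; first by left.
  exact: leq_trans (r_lt x xr) ny.
have [||s' [t' [Bs' Bt' st' stY' wst]]] := XO Y.
- by apply: sub_infinite_set (infinite_above (n := n) Xinf); right.
- by move=> x [/=|[]//]; rewrite inE => /orP[/sX|/tX].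
have [sY tY] := triangle_initial_segments st stY.
have [s'Y t'Y] := triangle_initial_segments st' stY'.
rewrite (barrier_initial_segment_inj Bs Bs' sY s'Y).
by rewrite (barrier_initial_segment_inj Bt Bt' tY t'Y).
Qed.

End Barrier.

(** * Types of barriers *)

Local Open Scope quotient_scope.
Local Open Scope order_scope.

(** [k y] is the least strict upper bound of the earlier values, and [k y <= h y] by induction, so E
    never runs out of room. Taking least bounds leaves no gaps. *)
Lemma mostowski_collapse (T : Type) (R : rel T) d (E : orderType d) (h : T -> E) :
    well_order (<=%O : rel E) -> transitive R -> {homo h : x y / R x y >-> x < y} ->
  exists k : T -> E, {homo k : x y / R x y >-> x < y} /\
    forall y e, e < k y -> exists2 x, R x y & k x = e.
Proof.
move=> Ewo Rtrans h_homo.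
have Rwf : well_founded (fun x y => R x y).
  move=> x; apply: contrapT => nAx.
  have [|_ [y nAy <-] y_min] := @well_order_min _ E (h @` [set y | ~ Acc R y]) Ewo.
    by exists (h x), x.
  apply: nAy; constructor=> z Rzy; apply: contrapT => nAz.
  by have := h_homo z y Rzy; rewrite ltNge y_min //; exists z.
pose lub y (rec : forall x, R x y -> E) : set E :=
  [set e | (forall x xy, rec x xy < e) /\
           forall e', (forall x xy, rec x xy < e') -> e <= e'].
(* The default [h y] only makes the recursion total; [kP] shows that the least bound exists. *)
pose step y (rec : forall x, R x y -> E) : E := xget (h y) (lub y rec).
pose k := Fix Rwf (fun _ => E) step.
have kE y : k y = xget (h y) (lub y (fun x _ => k x)).
  rewrite /k Fix_eq // => x f g fg; congr (step x _).
  by apply: functional_extensionality_dep => z; apply: funext => Rzx.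
have kP y : lub y (fun x _ => k x) (k y) /\ k y <= h y.
  elim/(well_founded_ind Rwf): y => y IH.
  have [|e e_lub e_min] := @well_order_min _ E (fun e => forall x, R x y -> k x < e) Ewo.
    by exists (h y) => x xy; apply: le_lt_trans (h_homo x y xy); apply: (IH x xy).2.
  have lubk : lub y (fun x _ => k x) (k y).
    by rewrite [k y]kE; apply: (@xgetPex _ (h y)); exists e.
  split=> //; apply: lubk.2 => x xy.
  by apply: le_lt_trans (h_homo x y xy); apply: (IH x xy).2.
exists k; split=> [x y xy|]; first by have [[+ _] _] := kP y; apply.
move=> y; elim/(well_founded_ind Rwf): y => y IH e ey.
have [x xy ex] : exists2 x, R x y & e <= k x.
  apply: contrapT => nx; have [[_ k_min] _] := kP y.
  move: ey; rewrite ltNge => /negP; apply; apply: k_min => x xy.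
  by rewrite ltNge; apply/negP => ex; apply: nx; exists x.
move: ex; rewrite le_eqVlt => /predU1P[->|ex]; first by exists x.
have [z zx kz] := IH x xy e ex; by exists z => //; apply: Rtrans xy.
Qed.

Lemma lex_lt_trans : transitive lex_lt.
Proof. by move=> t s u; apply: lt_trans. Qed.

Section Wqo.
Variables (dE : Order.disp_t) (E : orderType dE).
Hypothesis Ewo : well_order (<=%O : rel E).

(** The restriction of [h] to [C] is increasing, but its image may have gaps; collapsing closes
    them. *)
Lemma barrier_type_le_sub (B C : set {fset nat}) : C `<=` B ->
  barrier_type_le B E -> barrier_type_le C E.
Proof.
move=> CB [h [h_homo _]].
pose incl (s : C) : B := exist _ (val s) (mem_set (CB _ (set_mem (valP s)))).
have [||k [k_homo k_init]] := @mostowski_collapse C (fun s t => lex_lt (val s) (val t)) _ E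
    (h \o incl) Ewo.
- by move=> t s u; apply: lex_lt_trans.
- by move=> s t st; apply: h_homo.
by exists k; split=> // s e /k_init[t _]; exists t.
Qed.

Lemma wqo_pair dQ (Q : porderType dQ) dA (A : orderType dA) (B : set {fset nat})
    (g : {fset nat} -> Q) (w : {fset nat} -> A) :
    wqo E Q -> well_order (<=%O : rel A) -> barrier B -> barrier_type_le B E ->
  exists s t, [/\ B s, B t, triangle s t, g s <= g t & w s <= w t].
Proof.
move=> Qwqo Awo Bbar Btype.
have [X [Xinf XB Xw]] := barrier_monotone Bbar w Awo.
have CB : sub_barrier B X `<=` B by move=> s [].
have [s [t [st gst]]] := Qwqo _ (sub_barrierP Bbar Xinf XB)
  (barrier_type_le_sub CB Btype) (fun s => g (val s)).
have Cs := set_mem (valP s); have Ct := set_mem (valP t).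
by exists (val s), (val t); split; [apply: CB|apply: CB| | |apply: Xw].
Qed.

End Wqo.

(** * The barrier of singletons and minimal elements *)

Lemma increasing_enum1 n : increasing_enum [fset n]%fset = [:: n].
Proof. by rewrite /increasing_enum -fset_seq1. Qed.

Lemma fset_min1 n : fset_min [fset n]%fset = n.
Proof. by rewrite /fset_min increasing_enum1. Qed.

Lemma lex_lt1 n m : lex_lt [fset n]%fset [fset m]%fset = (n < m)%N.
Proof.
rewrite /lex_lt !increasing_enum1 ltxi_cons ltxi0s eqxx implybF -ltNge.
by rewrite ltEnat leEnat; apply/andb_idl/ltnW.
Qed.

Definition singletons : set {fset nat} := range (fun n => [fset n]%fset).

Lemma singletons_barrier : barrier singletons.
Proof.
split.
- move=> /(finite_image fset_min); apply: sub_infinite_set infinite_nat => n _.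
  by exists [fset n]%fset; [exists n|apply: fset_min1].
- by move=> _ _ [n _ <-] [m _ <-]; rewrite fsub1set inE => /eqP ->.
- move=> X Xinf _; have [m Xm m_min] := set_nat_min (infinite_setN0 Xinf).
  exists [fset m]%fset; first by exists m.
  split=> [x /=|x y]; rewrite !inE => /eqP -> //.
  by move=> Xy ym; rewrite ltn_neqAle eq_sym ym m_min.
Qed.

Lemma wqo_sequence dE dQ (E : orderType dE) (Q : porderType dQ) (q : nat -> Q) :
    otype_le (ltn : rel nat) (<%O : rel E) -> wqo E Q ->
  exists i j, (i < j)%N /\ q i <= q j.
Proof.
move=> [h [h_homo h_init]] Qwqo.
have sE (s : singletons) : val s = [fset fset_min (val s)]%fset.
  by have [n _ <-] := set_mem (valP s); rewrite fset_min1.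
have [|s [t [[_ _ st _ _] qst]]] := Qwqo singletons singletons_barrier _
    (fun s => q (fset_min (val s))).
  exists (fun s => h (fset_min (val s))); split.
    by move=> s t st; apply: h_homo; rewrite /= -lex_lt1 -!sE.
  move=> s e /h_init[n <-].
  have ns : [fset n]%fset \in singletons by apply: mem_set; exists n.
  by exists (exist _ [fset n]%fset ns); rewrite /= fset_min1.
by exists (fset_min (val s)), (fset_min (val t)).
Qed.

Lemma wqo_pow_minimal dE dA d (E : orderType dE) (A : orderType dA)
    (P : porderType d) : [set: A] !=set0 -> [set: P] !=set0 ->
    otype_le (ltn : rel nat) (<%O : rel E) -> wqo E (pow A P) ->
  exists p : P, forall q, q <= p -> q = p.
Proof.
move=> [a _] [p0 _] omegaE Pwqo; apply: contrapT => nmin.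
have lower (p : P) : exists q, q < p.
  apply: contrapT => np; apply: nmin; exists p => q.
  by rewrite le_eqVlt => /predU1P[//|qp]; case: np; exists q.
have [f fP] := choice lower.
pose p i := iter i f p0.
have p_decr i j : (i < j)%N -> p j < p i.
  elim: j => // j IH; rewrite ltnS leq_eqVlt => /predU1P[->|/IH]; first exact: fP.
  by apply: lt_trans; apply: fP.
have [i [j [ij]]] := wqo_sequence
  (fun i => \pi_(antisymmetrization (pow_seq A P)) (fun=> p i)) omegaE Pwqo.
rewrite le_pi => /asboolP[rho [_ /(_ a)]] /(lt_le_trans (p_decr i j ij)).
by rewrite ltxx.
Qed.

(** * Padding *)

Section Padding.
Variables (dA d : Order.disp_t) (A : orderType dA) (P : porderType d) (p : P).
Hypothesis Awo : well_order (<=%O : rel A).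
Hypothesis p_min : forall q, q <= p -> q = p.

Definition pad (l : lpow_seq A P) : pow_seq A P :=
  fun x => if insub x is Some y then tagged l y else p.

Let pad_lt (l : lpow_seq A P) (x : seg (tag l)) : pad l (val x) = tagged l x.
Proof. by rewrite /pad valK. Qed.

Let pad_ge (l : lpow_seq A P) (x : A) : tag l <= x -> pad l x = p.
Proof. by move=> lx; rewrite /pad insubN // -leNgt. Qed.

(* bk = (b, k), where the final block of p's of l starts at b, and k x is the *)
(* order type of the interval from b to x (excluded).                         *)
Let tailP (l : lpow_seq A P) : exists bk : A * (A -> A),
  [/\ bk.1 <= tag l, forall x, bk.1 <= x -> pad l x = p,
      forall y, y < bk.1 -> exists x, [/\ y <= x, x < bk.1 & pad l x != p],
      forall x y, bk.1 <= x -> x < y -> bk.2 x < bk.2 y &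
      forall y e, e < bk.2 y -> exists x, [/\ bk.1 <= x, x < y & bk.2 x = e]].
Proof.
have [|b b_tail b_min] := @well_order_min _ A
    (fun b => forall x, b <= x -> pad l x = p) Awo.
  by exists (tag l) => x; apply: pad_ge.
have [||k [k_homo k_init]] := @mostowski_collapse A (fun x y => (b <= x) && (x < y)) _ A id Awo.
- by move=> y x z /andP[bx xy] /andP[_ yz]; rewrite bx (lt_trans xy yz).
- by move=> x y /andP[].
exists (b, k); split=> //=.
- by apply: b_min => x; apply: pad_ge.
- move=> y yb; apply: contrapT => ny.
  move: yb; rewrite ltNge => /negP; apply; apply: b_min => x yx.
  have [/b_tail//|xb] := leP b x; apply/eqP; apply: contrapT => /negP xp.
  by apply: ny; exists x.
- by move=> x y bx xy; apply: k_homo; rewrite bx.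
- by move=> y e /k_init[x /andP[bx xy] <-]; exists x.
Qed.

(** The new embedding follows [rho] before the final block of [l] and on the block matches positions
    of equal rank, which [w l <= w m] makes possible. *)
Lemma exists_padding : exists w : lpow_seq A P -> A, forall l m,
  pad l <= pad m -> w l <= w m -> l <= m.
Proof.
have [bk bkP] := choice tailP.
exists (fun l => (bk l).2 (tag l)) => l m /asboolP[rho [rho_incr rho_le]] wlm.
have [bl l_tail l_dense k_incr _] := bkP l.
have [bm m_tail _ k'_incr k'_init] := bkP m.
move: (bk l) (bk m) bl l_tail l_dense k_incr bm m_tail k'_incr k'_init wlm.
move=> [b k] [b' k'] /= bl l_tail l_dense k_incr bm m_tail k'_incr k'_init wlm.
(* Some term at [y] with [x <= y < b] differs from [p]. If [rho x] reached the final block of [m],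
   so would [rho y], putting that term below the minimal [p]. *)
have rho_b x : x < b -> rho x < b'.
  move=> /l_dense[y [xy yb /eqP yp]]; rewrite ltNge; apply/negP => b'x.
  apply: yp; apply: p_min; rewrite -(m_tail (rho y)) //.
  apply: le_trans b'x _; move: xy; rewrite le_eqVlt => /predU1P[->//|/rho_incr].
  exact: ltW.
have sigma_ex x : exists y, b <= x -> x < tag l ->
    [/\ b' <= y, y < tag m & k' y = k x].
  have [/andP[bx xl]|nx] := boolP ((b <= x) && (x < tag l)); last first.
    by exists x => bx xl; rewrite bx xl in nx.
  have [|y [by_ ym kxy]] := k'_init (tag m) (k x); last by exists y.
  by apply: lt_le_trans wlm; apply: k_incr.
have [sigma sigmaP] := choice sigma_ex.
pose tau x := if x < b then rho x else sigma x.
have tau_lt x : x < tag l -> tau x < tag m.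
  move=> xl; rewrite /tau; have [xb|bx] := ltP x b.
    exact: lt_le_trans (rho_b x xb) bm.
  by have [] := sigmaP x bx xl.
apply/asboolP; exists (fun x : seg (tag l) => exist _ (tau (val x)) (tau_lt _ (valP x))).
split=> [x y xy|x].
  have {xy} xy : val x < val y by [].
  suff : tau (val x) < tau (val y) by [].
  rewrite /tau; have [yb|by_] := ltP (val y) b.
    by rewrite (lt_trans xy yb); apply: rho_incr.
  have [b'y ym ky] := sigmaP _ by_ (valP y).
  have [xb|bx] := ltP (val x) b; first exact: lt_le_trans (rho_b _ xb) b'y.
  have [b'x xm kx] := sigmaP _ bx (valP x).
  have kxy : k (val x) < k (val y) by apply: k_incr.
  rewrite ltNge; apply/negP; rewrite le_eqVlt => /predU1P[yx|yx].
    by move: kxy; rewrite -kx -ky yx ltxx.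
  by have := k'_incr _ _ b'y yx; rewrite kx ky ltNge (ltW kxy).
rewrite -[tagged l x]pad_lt -pad_lt /= /tau; have [xb|bx] := ltP (val x) b.
  exact: rho_le.
have [b'x _ _] := sigmaP _ bx (valP x).
by rewrite l_tail // m_tail.
Qed.

End Padding.

Theorem mainTheorem1 (d dA dE : Order.disp_t) (P : porderType d)
    (A : orderType dA) (E : orderType dE)
    (hA : countable_ordinal A) (A0 : [set: A] !=set0)
    (hE : countable_ordinal E)
    (omega_le_E : otype_le (ltn : rel nat) (<%O : rel E)) :
  wqo E (pow A P) -> wqo E (lpow A P).
Proof.
move=> Pwqo B Bbar Btype f.
have [Awo _] := hA; have [Ewo _] := hE.
have [s0 [t0 [Bs0 Bt0 st0]]] := exists_triangle Bbar.
pose at_ s (Bs : B s) : B := exist _ s (mem_set Bs).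
have [P0|/set0P/= PN0] := eqVneq [set: P] set0.
  (* Without values in P every sequence has empty domain, so any triangle is a good pair. *)
  have Pempty (p : P) : False by rewrite -[False]/(set0 p) -P0.
  exists (at_ s0 Bs0), (at_ t0 Bt0); split=> //.
  apply/asboolP; exists (fun x => False_rect _ (Pempty (tagged (repr (f (at_ s0 Bs0))) x))).
  by split=> x; case: (Pempty (tagged (repr (f (at_ s0 Bs0))) x)).
have [p p_min] := wqo_pow_minimal A0 PN0 omega_le_E Pwqo.
have [w wP] := exists_padding Awo p_min.
(* [wqo_pair] expects maps on all finite sets; outside [B] the value at [s0] serves as a default. *)
pose F s := repr (f (insubd (at_ s0 Bs0) s)).
have FE s (Bs : B s) : F s = repr (f (at_ s Bs)).
  by congr (repr (f _)); apply: val_inj; rewrite val_insubd mem_set.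
have [s [t [Bs Bt st gst wst]]] := wqo_pair Ewo
  (fun s => \pi_(antisymmetrization (pow_seq A P)) (pad p (F s)))
  (fun s => w (F s)) Pwqo Awo Bbar Btype.
exists (at_ s Bs), (at_ t Bt); split=> //.
suff : F s <= F t by rewrite !FE.
by apply: wP wst; rewrite -le_pi.
Qed.
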